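(* For every instance of FZA, the simplified Single Density algorithm outputs a random set $F_{\mathrm{ALG}}\subseteq E$ whose expected revenue is at least $\mathrm{OPT}/\mathcal{O}(\log n)$, where $\mathrm{OPT}$ is the optimal revenue; i.e., it computes an $\mathcal{O}(\log n)$-approximation for FZA in expectation.
   Context: FZA: given a tree $T=(V,E)$ with $n=|V|$, a non-decreasing concave $f\colon\mathbb{N}_0\to\mathbb{R}_{\ge0}$ and commodities $i\in[k]$ with path $P_i\subseteq E$, bound $u_i\in\mathbb{N}_0$ and weight $w_i\in\mathbb{N}$, maximize $\mathrm{rev}(F)=\sum_i\mathrm{rev}_i(F)$ over $F\subseteq E$, where $\mathrm{rev}_i(F)=w_if(|P_i\cap F|)$ if $|P_i\cap F|\le u_i$ and $0$ otherwise. Simplified Single Density algorithm: set $F_0=\emptyset$; for each $j\in\{1,\dots,\lceil\log_2 n\rceil\}$, form $F_j$ by including each edge of $E$ independently with probability $2^{-j-1}$; return a maximum-revenue set among $F_0,F_1,\dots,F_{\lceil\log_2 n\rceil}$. *)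

(* Defs.v *)
From HB Require Import structures.
From mathcomp Require Import all_boot all_order all_algebra.
From mathcomp Require Import all_classical all_reals all_analysis.

Set Implicit Arguments.
Unset Strict Implicit.
Unset Printing Implicit Defensive.

Import Order.TTheory GRing.Theory Num.Theory.

Local Open Scope ring_scope.

(* A simple graph is a symmetric irreflexive relation [adj]; its edges are the
   unordered pairs of adjacent vertices. *)
Section Graph.
Variables (V : finType) (adj : rel V).

Definition is_tree : Prop :=
  [/\ symmetric adj, irreflexive adj, (0 < #|V|)%N,
      (forall x y : V, connect adj x y) &
      forall c : seq V, (2 < size c)%N -> ~ ucycle adj c].

Definition edges : {set {set V}} :=
  [set e : {set V} | [exists x, exists y, adj x y && (e == [set x; y]%SET)]]%SET.

(* [P] is the edge set of a simple path; the trivial path is allowed. *)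
Definition is_path (P : {set {set V}}) : Prop :=
  exists (x : V) (p : seq V),
    [/\ path adj x p, uniq (x :: p) &
        P = [set:: pairmap (fun a b : V => [set a; b]%SET) x p]%SET].

End Graph.

(* Concavity on the domain of natural numbers: Jensen's inequality for every
   convex combination of two points of the domain that lies in the domain. *)
Definition concave_nat (R : realType) (f : nat -> R) : Prop :=
  forall (a b c : nat) (t : R), 0 <= t <= 1 ->
    c%:R = t * a%:R + (1 - t) * b%:R -> t * f a + (1 - t) * f b <= f c.

Record fza (R : realType) := FZA {
  vert : finType;
  adj : rel vert;
  adj_tree : is_tree adj;
  fare : nat -> R;
  fare_ge0 : forall m, 0 <= fare m;
  fare_nondecr : forall m m', (m <= m')%N -> fare m <= fare m';
  fare_concave : concave_nat fare;
  ncom : nat;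
  cpath : 'I_ncom -> {set {set vert}};
  cpathP : forall i, is_path adj (cpath i);
  bound : 'I_ncom -> nat;
  weight : 'I_ncom -> nat;
  weight_gt0 : forall i, (0 < weight i)%N }.

Arguments adj {R} f.
Arguments fare {R} f.
Arguments cpath {R} f i.
Arguments bound {R} f i.
Arguments weight {R} f i.

Section Revenue.
Variables (R : realType) (I : fza R).

Definition nvert : nat := #|vert I|.

Definition edge_set : {set {set vert I}} := edges (adj I).

Definition revenue_com (i : 'I_(ncom I)) (F : {set {set vert I}}) : R :=
  let m := #|cpath I i :&: F| in
  if (m <= bound I i)%N then (weight I i)%:R * fare I m else 0.

Definition revenue (F : {set {set vert I}}) : R :=
  \sum_(i < ncom I) revenue_com i F.

Definition OPT : R :=
  \big[Num.max/revenue finset.set0]_(F : {set {set vert I}} | F \subset edge_set)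
    revenue F.

End Revenue.

Section Randomness.
Variables (R : realType) (d : measure_display) (T : measurableType d).
Variables (P : probability T R) (A : finType).

Definition random_set (X : T -> {set A}) : Prop :=
  forall S : {set A}, measurable [set w | X w = S]%classic.

(* Mutual independence of the events [e \in X], [e \in E]: the product rule
   holds for every finite subfamily. *)
Definition includes_independently (E : {set A}) (p : R) (X : T -> {set A}) :
    Prop :=
  [/\ random_set X,
      forall w, X w \subset E,
      forall e, e \in E -> P [set w | e \in X w]%classic = p%:E &
      forall S : {set A}, S \subset E ->
        P (\bigcap_(e in [set` S]) [set w | e \in X w])%classic =
        (\prod_(e in S) P [set w | e \in X w]%classic)%E].

End Randomness.

(* A random execution of the algorithm on the probability space [(T, P)]:
   [Fs j] is the set formed in round [j] and [Falg] the returned set, with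
   arbitrary tie-breaking; [up_log 2 n] is the ceiling of the binary logarithm
   of [n]. *)
Definition single_density (R : realType) (I : fza R) (d : measure_display)
    (T : measurableType d) (P : probability T R)
    (Fs : nat -> T -> {set {set vert I}}) (Falg : T -> {set {set vert I}}) :
    Prop :=
  let L := up_log 2 (nvert I) in
  [/\ forall w, Fs 0%N w = finset.set0,
      forall j, (1 <= j <= L)%N ->
        includes_independently P (edge_set I) (2 ^- j.+1) (Fs j),
      random_set Falg,
      forall w, exists2 j, (j <= L)%N & Falg w = Fs j w &
      forall w j, (j <= L)%N -> revenue (Fs j w) <= revenue (Falg w)].

(* Main.v *)
Require Import Defs.
From HB Require Import structures.
From mathcomp Require Import all_boot all_order all_algebra.
From mathcomp Require Import all_classical all_reals all_analysis.
From mathcomp Require Import measurable_realfun lra.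

(** Fix a feasible set [F] and a commodity with path [Q], and let
    [m = #|Q :&: F|] be within its bound.  If [m = 0], round [0] already earns
    its revenue.  Otherwise some round [j] has mean hit count
    [mu = #|Q| / 2 ^ (j + 1)] in [[m / 4, m / 2]].  With [x] the number of edges
    of [Q] drawn in that round, concavity gives [f x >= (x / m) f m] for
    [x <= m], and [E[x 1_{x <= m}] >= mu - mu ^ 2 / m >= m / 8], so the round
    earns in expectation an eighth of the commodity's revenue.  Summing over the
    commodities and over the [ceil (log2 n) + 1] rounds, each of which the
    returned set beats, gives [OPT <= 8 (ceil (log2 n) + 1) E[rev (Falg)]]. *)

Set Implicit Arguments.
Unset Strict Implicit.
Unset Printing Implicit Defensive.

Import Order.TTheory GRing.Theory Num.Theory.
Import numFieldNormedType.Exports.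

Local Open Scope classical_set_scope.
Local Open Scope ring_scope.

(** * Laws of random subsets of a finite type *)

(** Real-valued point masses, so that expectations become finite sums in [R] that can be reordered
    freely. *)
Definition law {R : realType} {d : measure_display} {T : measurableType d}
  (P : probability T R) {A : finType} (X : T -> {set A}) (S : {set A}) : R :=
  fine (P [set w | X w = S]).

Section RandomSet.
Variables (R : realType) (d : measure_display) (T : measurableType d).
Variables (P : probability T R) (A : finType) (X : T -> {set A}).
Hypothesis rX : random_set X.

Lemma random_set_measurable (B : pred {set A}) :
  measurable [set w | B (X w)].
Proof.
have -> : [set w | B (X w)] = \bigcup_(S in [set S | B S]) [set w | X w = S].
  by apply/seteqP; split=> [w Bw|w [S BS /= ->] //]; exists (X w).
by apply: fin_bigcup_measurable => [|S _]; [exact: finite_finset|exact: rX].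
Qed.

Lemma measurable_fun_random_set (h : {set A} -> R) :
  measurable_fun setT (fun w => h (X w)).
Proof.
move=> _ Y mY; rewrite setTI.
have -> : (fun w => h (X w)) @^-1` Y = [set w | `[< Y (h (X w)) >]].
  by apply/seteqP; split=> w /= /asboolP.
exact: (random_set_measurable (fun S => `[< Y (h S) >])).
Qed.

Lemma law_ge0 (S : {set A}) : 0 <= law P X S.
Proof. by rewrite /law fine_ge0. Qed.

Lemma expectation_law (h : {set A} -> R) : (forall S, 0 <= h S) ->
  'E_P[fun w => h (X w)]%E = (\sum_(S : {set A}) h S * law P X S)%:E.
Proof.
move=> h0; rewrite unlock.
(* Since [X] takes finitely many values, [h (X w)] is a simple function: exactly one indicator in
   the sum is nonzero at each [w]. *)
transitivity (\int[P]_w (\sum_S (h S * \1_[set w | X w = S] w)%:E))%E.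
  apply: eq_integral => w _.
  rewrite (bigD1 (X w)) //= big1 ?adde0 => [|S SX].
    by rewrite indicE mem_set // mulr1.
  by rewrite indicE memNset ?mulr0 //= => XS; rewrite XS eqxx in SX.
rewrite ge0_integral_sum //; last 2 first.
- move=> S; apply/measurable_EFinP; apply: measurable_funM => //.
- by move=> S w _; rewrite lee_fin mulr_ge0.
rewrite -sumEFin; apply: eq_bigr => S _.
under eq_integral do rewrite EFinM.
rewrite ge0_integralZl_EFin //; last exact/measurable_EFinP/measurable_indic.
by rewrite integral_indic // setIT EFinM fineK // fin_num_measure.
Qed.

Lemma law_pred (B : pred {set A}) :
  \sum_(S : {set A}) (B S)%:R * law P X S = fine (P [set w | B (X w)]).
Proof.
have /(congr1 fine) /= <- := @expectation_law (fun S => (B S)%:R) (fun=> ler0n _ _).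
rewrite unlock; congr fine.
have mB := random_set_measurable B.
rewrite -[X in _ = P X]setIT -integral_indic //.
apply: eq_integral => w _; rewrite indicE.
by case: (boolP (B (X w))) => Bw; [rewrite mem_set|rewrite memNset //=; exact/negP].
Qed.

End RandomSet.

(** * Moments of the hit count [#|Q :&: X|] under independent inclusion *)

Section Moments.
Variables (R : realType) (d : measure_display) (T : measurableType d).
Variables (P : probability T R) (A : finType) (X : T -> {set A}).
Variables (E : {set A}) (p : R).
Hypothesis indepX : includes_independently P E p X.

Lemma law_mem (e : A) : e \in E -> \sum_(S : {set A}) (e \in S)%:R * law P X S = p.
Proof.
case: indepX => rX _ Pe _ eE.
by rewrite (law_pred P rX (fun S => e \in S)) Pe.
Qed.

Lemma law_mem2 (e e' : A) : e \in E -> e' \in E -> e != e' ->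
  \sum_(S : {set A}) ((e \in S) && (e' \in S))%:R * law P X S = p ^+ 2.
Proof.
case: indepX => rX _ Pe indep eE e'E ne.
rewrite (law_pred P rX (fun S => (e \in S) && (e' \in S))).
have : [set e; e']%SET \subset E by rewrite finset.subUset !finset.sub1set eE.
move=> /indep.
rewrite big_setU1 ?inE //= big_set1 !Pe // => H.
suff -> : [set w | (e \in X w) && (e' \in X w)] =
    \bigcap_(x in [set` [set e; e']%SET]) [set w | x \in X w] by rewrite H.
apply/seteqP; split=> w /=.
  by move=> /andP[ew e'w] x /=; rewrite !inE => /orP[] /eqP ->.
by move=> H'; rewrite !H' //= !inE eqxx ?orbT.
Qed.

Lemma natr_cardsI (Q S : {set A}) : #|Q :&: S|%:R = \sum_(e in Q) (e \in S)%:R :> R.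
Proof.
rewrite -sum1_card natr_sum (eq_bigl (fun e => (e \in Q) && (e \in S))); last first.
  by move=> e; rewrite inE.
by rewrite big_mkcondr /=; apply: eq_bigr => e _; case: (e \in S).
Qed.

Lemma law_mean (Q : {set A}) : Q \subset E ->
  \sum_(S : {set A}) #|Q :&: S|%:R * law P X S = #|Q|%:R * p.
Proof.
move=> /fintype.subsetP QE.
under eq_bigr do rewrite natr_cardsI mulr_suml.
rewrite exchange_big /= (eq_bigr (fun=> p)); last by move=> e /QE /law_mem.
by rewrite sumr_const mulr_natl.
Qed.

(** The square expands over ordered pairs of elements of [Q]: a diagonal pair contributes [p], any
    other pair [p ^+ 2]. *)
Lemma law_second_moment (Q : {set A}) : Q \subset E ->
  \sum_(S : {set A}) #|Q :&: S|%:R ^+ 2 * law P X S =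
  #|Q|%:R * p + #|Q|%:R * (#|Q|%:R - 1) * p ^+ 2.
Proof.
move=> /fintype.subsetP QE.
under eq_bigr do rewrite natr_cardsI expr2 mulr_suml mulr_suml.
rewrite exchange_big /=.
rewrite (eq_bigr (fun=> p + (#|Q|%:R - 1) * p ^+ 2)); last first.
  move=> e eQ; under eq_bigr do rewrite mulr_sumr mulr_suml.
  rewrite exchange_big /= (bigD1 e) //=; congr (_ + _).
    rewrite -[RHS](law_mem (QE _ eQ)); apply: eq_bigr => S _.
    by rewrite -natrM mulnb andbb.
  rewrite (eq_bigr (fun=> p ^+ 2)) => [|e' /andP[e'Q ne]].
    rewrite sumr_const -[LHS]mulr_natl; congr (_ * _).
    rewrite (cardD1 e Q) eQ /= natrD addrAC subrr add0r; congr _%:R.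
    by apply: eq_card => x; rewrite !inE andbC.
  rewrite -(@law_mem2 e e') ?QE 1?eq_sym //.
  by apply: eq_bigr => S _; rewrite -natrM mulnb.
by rewrite sumr_const -[LHS]mulr_natl mulrDr mulrA.
Qed.

(* The polynomial bound [x 1_{x <= m} >= x - x (x - 1) / m] on naturals reduces
   the truncated mean to pairwise probabilities. *)
Lemma law_truncated_mean (Q : {set A}) (m : nat) : Q \subset E -> (0 < m)%N ->
  #|Q|%:R * p - (#|Q|%:R * p) ^+ 2 / m%:R <=
  \sum_(S : {set A}) (if (#|Q :&: S| <= m)%N then #|Q :&: S|%:R else 0) * law P X S.
Proof.
move=> QE m0.
have mR : 0 < m%:R :> R by rewrite ltr0n.
apply: (@le_trans _ _ (\sum_(S : {set A}) (#|Q :&: S|%:R -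
    (#|Q :&: S|%:R ^+ 2 - #|Q :&: S|%:R) / m%:R) * law P X S)).
  under eq_bigr do rewrite mulrBl mulrAC mulrBl.
  rewrite sumrB -mulr_suml sumrB law_mean // law_second_moment //.
  (* The linear terms of the two moments cancel, leaving [#|Q| (#|Q| - 1) p ^+ 2], at most the
     squared mean. *)
  rewrite lerD2l lerN2 ler_pM2r ?invr_gt0 // addrAC subrr add0r.
  by rewrite exprMn ler_wpM2r ?sqr_ge0 // expr2 ler_wpM2l // gerBl.
apply: ler_sum => S _; rewrite ler_wpM2r ?law_ge0 //.
set x := #|_|; have x0 : 0 <= x%:R :> R by [].
(* If [x <= m], the subtracted term is nonnegative because [x <= x ^ 2] on naturals. If [x > m],
   then [x - 1 >= m] makes the polynomial nonpositive. *)
case: leqP => [_|xm].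
  rewrite gerBl divr_ge0 //.
  rewrite subr_ge0; case: x x0 => [|x] x0; first by rewrite expr0n.
  by rewrite expr2 ler_peMl // ler1n.
rewrite subr_le0 ler_pdivlMr // expr2 -[X in _ - X]mulr1 -mulrBr.
by rewrite ler_wpM2l // lerBrDr natr1 ler_nat.
Qed.

End Moments.

(** * Paths, concavity and the choice of the round *)

Lemma path_subset_edges (V : finType) (e : rel V) (Q : {set {set V}}) :
  is_path e Q -> Q \subset edges e.
Proof.
move=> [x [p [ep _ ->]]]; apply/fintype.subsetP => s; rewrite inE.
elim: p x ep => //= y p IHp x /andP[exy ep].
rewrite inE => /orP[/eqP ->|]; last exact: IHp ep.
by rewrite inE; apply/existsP; exists x; apply/existsP; exists y; rewrite exy /=.
Qed.

Lemma card_path (V : finType) (e : rel V) (Q : {set {set V}}) :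
  is_path e Q -> (#|Q| < #|V|)%N.
Proof.
move=> [x [p [_ /card_uniqP /= xp ->]]].
apply: (@leq_trans (size p).+1); last by rewrite -xp max_card.
by rewrite ltnS cardsE (leq_trans (card_size _)) ?size_pairmap.
Qed.

(** Jensen between [m] and [0] with weight [x / m] on [m]; the nonnegative share of [f 0] is
    dropped. *)
Lemma concave_nat_scale (R : realType) (f : nat -> R) (x m : nat) :
  concave_nat f -> 0 <= f 0%N -> (0 < m)%N -> (x <= m)%N ->
  x%:R / m%:R * f m <= f x.
Proof.
move=> cf f0 m0 xm.
have mR : 0 < m%:R :> R by rewrite ltr0n.
have t01 : 0 <= (x%:R / m%:R : R) <= 1.
  by rewrite divr_ge0 //= ler_pdivrMr // mul1r ler_nat.
apply: le_trans (cf m 0%N x _ t01 _).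
  by rewrite lerDl mulr_ge0 // subr_ge0; case/andP: t01.
by rewrite mulr0 addr0 divfK // gt_eqF.
Qed.

(** Take the least [j >= 1] with [l <= m 2 ^ j]. This inequality is the upper bound, and its failure
    at [j - 1] gives the lower one. *)
Lemma exists_density (R : realType) (l m L : nat) :
  (0 < m <= l)%N -> (0 < L)%N -> (l <= 2 ^ L)%N ->
  exists2 j, (1 <= j <= L)%N &
    m%:R / 4 <= (l%:R * 2 ^- j.+1 : R) <= m%:R / 2.
Proof.
move=> /andP[m0 ml] L0 lL.
have ex : exists j, (0 < j)%N && (l <= m * 2 ^ j)%N.
  by exists L; rewrite L0 (leq_trans lL) // leq_pmull.
case: (ex_minnP ex) => j /andP[j0 lj] jmin; exists j.
  by rewrite j0 jmin // L0 (leq_trans lL) // leq_pmull.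
have p2 k : 0 < 2 ^+ k :> R by rewrite exprn_gt0.
apply/andP; split; last first.
  rewrite ler_pdivrMr // exprS mulrA divfK ?pnatr_eq0 //.
  by rewrite -natrX -natrM ler_nat.
case: j j0 lj jmin => // -[|j] _ _ jmin.
  (* At [j = 1] there is no earlier round to compare with; the lower bound is then just [m <= l]. *)
  by rewrite ler_pM ?invr_ge0 // ?ler_nat // -natrX.
have : (m * 2 ^ j.+1 < l)%N.
  by rewrite ltnNge; apply/negP => lj; have := jmin j.+1; rewrite lj ltnn => /(_ isT).
move=> /ltnW; rewrite -(ler_nat R) natrM natrX => lj.
rewrite ler_pdivlMr // (le_trans _ lj) // 2!exprS.
lra.
Qed.

(** * Expected revenue of the rounds and of the returned set *)

Section Revenue.
Variables (R : realType) (I : fza R).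

Lemma revenue_com_ge0 (i : 'I_(ncom I)) F : 0 <= revenue_com i F.
Proof. by rewrite /revenue_com; case: ifP => // _; rewrite mulr_ge0 // fare_ge0. Qed.

Lemma revenue_ge0 (F : {set {set vert I}}) : 0 <= revenue F.
Proof. by rewrite sumr_ge0 // => i _; exact: revenue_com_ge0. Qed.

Variables (d : measure_display) (T : measurableType d) (P : probability T R).

Lemma revenue_com_density (i : 'I_(ncom I)) (m : nat) (p : R)
    (X : T -> {set {set vert I}}) :
  includes_independently P (edge_set I) p X ->
  (0 < m <= bound I i)%N ->
  m%:R / 4 <= #|cpath I i|%:R * p <= m%:R / 2 ->
  (weight I i)%:R * fare I m <= 8 * \sum_S revenue_com i S * law P X S.
Proof.
move=> indepX /andP[m0 mu] /andP[].
have Qedge := path_subset_edges (cpathP i).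
have := law_truncated_mean indepX Qedge m0.
set mean := _ * p; set trunc := \sum_S _ => trunc_ge mean_ge mean_le.
have mR : 0 < m%:R :> R by rewrite ltr0n.
have trunc8 : m%:R <= 8 * trunc.
  suff : m%:R / 8 <= mean - mean ^+ 2 / m%:R by lra.
  (* From [mean <= m / 2] the quadratic loss is at most [mean / 2]; what remains is at least
     [mean / 2 >= m / 8]. *)
  suff : mean ^+ 2 / m%:R <= mean / 2 by lra.
  by rewrite ler_pdivrMr // expr2 -[leRHS]mulrA [_^-1 * _]mulrC ler_wpM2l //; lra.
set c := (weight I i)%:R * fare I m.
have c0 : 0 <= c by rewrite mulr_ge0 // fare_ge0.
apply: (@le_trans _ _ (8 * (c / m%:R * trunc))).
  rewrite mulrCA -mulrA ler_peMr // mulrC ler_pdivlMr // mul1r //.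
rewrite ler_pM2l // mulr_sumr; apply: ler_sum => S _.
rewrite mulrA ler_wpM2r ?law_ge0 // /revenue_com.
(* Up to [m] hits the bound of the commodity is respected, since [m] respects it; draws with more
   hits only need nonnegative revenue. *)
case: (leqP _ m) => [xm|_]; last by rewrite mulr0 revenue_com_ge0.
rewrite (leq_trans xm mu) /c.
rewrite -2!mulrA ler_wpM2l //.
have := concave_nat_scale (@fare_concave _ I) (fare_ge0 I 0) m0 xm.
by apply: le_trans; rewrite [leLHS]mulrC [_^-1 * _]mulrC.
Qed.

Variables (Fs : nat -> T -> {set {set vert I}}) (Falg : T -> {set {set vert I}}).
Hypothesis run : single_density P Fs Falg.
Let L := up_log 2 (nvert I).

Lemma random_set_round j : (j <= L)%N -> random_set (Fs j).
Proof.
case: run => F0 indep _ _ _; case: j => [|j] jL S; last by have [] := indep j.+1 jL.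
case: (eqVneq S finset.set0) => [->|S0].
  by rewrite (_ : [set _ | _] = setT) //; apply/seteqP; split=> w //= _; rewrite F0.
rewrite (_ : [set _ | _] = set0) //; apply/seteqP; split=> w //=.
by rewrite F0 => S0'; rewrite S0' eqxx in S0.
Qed.

(** The suitable round depends on [i] and [F]. Summing over all rounds removes this dependence, so
    the estimates can be added over the commodities. *)
Lemma revenue_com_le_rounds (i : 'I_(ncom I)) (F : {set {set vert I}}) :
  revenue_com i F <=
  8 * \sum_(j < L.+1) \sum_S revenue_com i S * law P (Fs j) S.
Proof.
case: run => F0 indep _ _ _.
have term_ge0 (j : 'I_L.+1) : 0 <= \sum_S revenue_com i S * law P (Fs j) S.
  by apply: sumr_ge0 => S _; rewrite mulr_ge0 ?revenue_com_ge0 ?law_ge0.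
suff [j jL le_j] : exists2 j : nat, (j < L.+1)%N &
    revenue_com i F <= 8 * \sum_S revenue_com i S * law P (Fs j) S.
  apply: (le_trans le_j); rewrite ler_pM2l // (bigD1 (Ordinal jL)) //= lerDl.
  exact: sumr_ge0.
rewrite {1}/revenue_com; case: ifP => [mu|_]; last first.
  by exists 0%N => //; rewrite mulr_ge0 ?(term_ge0 ord0).
case: (posnP #|cpath I i :&: F|) => [m0|m0].
  (* Round [0] is constantly empty, so its sum is the expectation of a constant: the revenue at zero
     hits, which is within every bound. *)
  exists 0%N => //; rewrite m0.
  have := random_set_round (leq0n L).
  move=> /(@expectation_law _ _ _ P _ _)/(_ _ (revenue_com_ge0 i)).
  under [in LHS]eq_fun do rewrite F0.
  rewrite expectation_cst => -[<-].
  rewrite /revenue_com finset.setI0 cards0 leq0n ler_peMl ?ler1n //.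
  by rewrite mulr_ge0 ?fare_ge0.
have lV := card_path (cpathP i).
have ml : (0 < #|cpath I i :&: F| <= #|cpath I i|)%N.
  by rewrite m0 finset.subset_leqif_cards // finset.subsetIl.
(* A path with an edge has two vertices, so at least one random round takes place. *)
have L0 : (0 < L)%N.
  rewrite up_log_gt0 /=; apply: leq_trans lV; rewrite ltnS.
  by case/andP: ml => ?; apply: leq_trans.
have lL : (#|cpath I i| <= 2 ^ L)%N.
  by apply: leq_trans (up_logP _ _) => //; exact: ltnW.
have [j jL dens] := exists_density R ml L0 lL.
exists j; first by case/andP: jL.
by apply: revenue_com_density (indep j jL) _ dens; rewrite m0.
Qed.

Lemma OPT_le_rounds :
  ((OPT I)%:E <= 8%:E * \sum_(j < L.+1) 'E_P[fun w => revenue (Fs j w)])%E.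
Proof.
have -> : (\sum_(j < L.+1) 'E_P[fun w => revenue (Fs j w)] =
    (\sum_(j < L.+1) \sum_S revenue S * law P (Fs j) S)%:E)%E.
  rewrite -sumEFin; apply: eq_bigr => j _; apply: expectation_law.
    by apply: random_set_round; rewrite -ltnS.
  exact: revenue_ge0.
rewrite -EFinM lee_fin.
suff rev_le (F : {set {set vert I}}) : revenue F <=
    8 * \sum_(j < L.+1) \sum_S revenue S * law P (Fs j) S.
  by apply: bigmax_le.
apply: (le_trans (ler_sum _ (fun i _ => revenue_com_le_rounds i F))).
rewrite -mulr_sumr ler_pM2l // exchange_big /=.
rewrite le_eqVlt; apply/predU1P; left; apply: eq_bigr => j _; rewrite exchange_big /=.
by apply: eq_bigr => S _; rewrite mulr_suml.
Qed.

Lemma single_density_approx :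
  ((OPT I / (8 * L.+1%:R))%:E <= 'E_P[fun w => revenue (Falg w)])%E.
Proof.
case: (run) => _ _ rAlg _ best.
have EAlg := expectation_law P rAlg revenue_ge0.
have /le_trans := OPT_le_rounds.
move=> /(_ (8%:E * \sum_(j < L.+1) 'E_P[fun w => revenue (Falg w)])%E) OPTle.
have : ((OPT I)%:E <= 8%:E * \sum_(j < L.+1) 'E_P[fun w => revenue (Falg w)])%E.
  apply: OPTle; rewrite lee_pmul2l ?lte_fin //; apply: lee_sum => j _.
  have jL : (j <= L)%N by rewrite -ltnS.
  apply: expectation_le => [||w|w|].
  - exact: (measurable_fun_random_set (random_set_round jL) (@revenue R I)).
  - exact: (measurable_fun_random_set rAlg (@revenue R I)).
  - exact: revenue_ge0.
  - exact: revenue_ge0.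
  - by apply: aeW => w; exact: best.
rewrite EAlg sumEFin -EFinM !lee_fin ler_pdivrMr ?mulr_gt0 ?ltr0n //.
by rewrite sumr_const card_ord -[X in 8 * X]mulr_natl mulrA mulrC.
Qed.

Lemma single_density_subset w : Falg w \subset edge_set I.
Proof.
case: run => F0 indep _ /(_ w)[[|j] jL ->] _.
  by rewrite F0 finset.sub0set.
by have [_ /(_ w)] := indep j.+1 jL.
Qed.

End Revenue.

(** * Growth of the approximation factor *)

Lemma up_log_bigO (R : realType) :
  (fun n : nat => 8 * (up_log 2 n).+1%:R : R) =O_\oo (fun n : nat => ln (n%:R : R)).
Proof.
(* The constant is [8 * 3 / ln 2]: with [up_log 2 n = k + 1] one has [2 ^ k < n], hence
   [2 ^ (k + 2) <= n ^ 3] for [n >= 2]. *)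
apply/eqO_exP; exists (24 / ln 2).
  by rewrite divr_gt0 // ln_gt0 // ltr1n.
near=> n.
have n2 : (1 < n)%N by near: n; exists 2%N.
have ln2 : 0 < ln 2 :> R by rewrite ln_gt0 // ltr1n.
have lnn : 0 <= ln n%:R :> R by rewrite ln_ge0 // ler1n ltnW.
rewrite !ger0_norm ?mulr_ge0 // mulrAC ler_pdivlMr //.
suff : (up_log 2 n).+1%:R * ln 2 <= 3 * ln n%:R :> R by lra.
have n0 : 0 < n%:R :> R by rewrite ltr0n ltnW.
rewrite !mulr_natl -!lnXn // ler_ln ?posrE ?exprn_gt0 // -!natrX ler_nat.
have /andP[+ _] := up_log_bounds (isT : (1 < 2)%N) n2.
have : (0 < up_log 2 n)%N by rewrite up_log_gt0.
case: (up_log 2 n) => // k _ /= /ltnW kn.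
by rewrite !expnS expn0 muln1 !leq_mul.
Unshelve. all: end_near. Qed.

Theorem theorem8 (R : realType) :
  exists g : nat -> R,
    [/\ forall n : nat, 0 < g n,
        g =O_\oo (fun n : nat => ln (n%:R : R)) &
        forall (I : fza R) (d : measure_display) (T : measurableType d)
               (P : probability T R) (Fs : nat -> T -> {set {set vert I}})
               (Falg : T -> {set {set vert I}}),
          single_density P Fs Falg ->
          (forall w : T, Falg w \subset edge_set I) /\
          ((OPT I / g (nvert I))%:E <= 'E_P[fun w : T => revenue (Falg w)])%E].
Proof.
(* The successor counts round [0] and keeps the factor positive where the logarithm vanishes. *)
exists (fun n => 8 * (up_log 2 n).+1%:R); split.
- by move=> n; rewrite mulr_gt0 ?ltr0n.
- exact: up_log_bigO.
- move=> I d T P Fs Falg run; split; first exact: single_density_subset run.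
  exact: single_density_approx run.
Qed.
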